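(* If a dynamical system $(X,f)$ has the average shadowing property, then it also has the $\underline{d}$-shadowing property and the $\overline{d}$-shadowing property.
   Context: $\mathbb{N}_0=\{0,1,2,\dots\}$. A dynamical system $(X,f)$ is a compact metric space $(X,d)$ together with a continuous map $f\colon X\to X$ (not assumed surjective). For $A\subset\mathbb{N}_0$, $\overline{d}(A)=\limsup_{n\to\infty}\frac1n|A\cap\{0,\dots,n-1\}|$ and $\underline{d}(A)=\liminf_{n\to\infty}\frac1n|A\cap\{0,\dots,n-1\}|$. A sequence $\{x_i\}_{i=0}^\infty\subset X$ is: a $\delta$-ergodic pseudo-orbit of $f$ if $\lim_{n\to\infty}\frac1n|\{0\le i<n: d(f(x_i),x_{i+1})\ge\delta\}|=0$; a $\delta$-average-pseudo-orbit if there is $N>0$ such that $\frac1n\sum_{i=0}^{n-1}d(f(x_{i+k}),x_{i+k+1})<\delta$ for all $n\ge N$ and all integers $k\ge0$. $(X,f)$ has the average shadowing property if for every $\varepsilon>0$ there is $\delta>0$ such that for every $\delta$-average-pseudo-orbit $\{x_i\}_{i=0}^\infty$ there is $z\in X$ with $\limsup_{n\to\infty}\frac1n\sum_{i=0}^{n-1}d(f^i(z),x_i)<\varepsilon$. $(X,f)$ has the $\underline{d}$-shadowing property (resp. the $\overline{d}$-shadowing property) if for every $\varepsilon>0$ there is $\delta>0$ such that for every $\delta$-ergodic pseudo-orbit $\{x_i\}_{i=0}^\infty$ there is $z\in X$ with $\underline{d}(\{i\in\mathbb{N}_0: d(f^i(z),x_i)<\varepsilon\})>0$ (resp. $\overline{d}(\{i\in\mathbb{N}_0: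 d(f^i(z),x_i)<\varepsilon\})>1/2$). *)

(* Defs.v *)
From HB Require Import structures.
From mathcomp Require Import all_boot all_order all_algebra.
From mathcomp Require Import all_classical all_reals all_analysis.

Set Implicit Arguments.
Unset Strict Implicit.
Unset Printing Implicit Defensive.

Import Order.TTheory GRing.Theory Num.Theory.
Import numFieldNormedType.Exports.

Local Open Scope classical_set_scope.
Local Open Scope ring_scope.

Section density.
Context {R : realType}.
Implicit Types A : set nat.

(* The value at n = 0 is 0, since 0^-1 = 0; it plays no role in the limits. *)
Definition frequency A (n : nat) : R :=
  n%:R^-1 * #|[pred i : 'I_n | val i \in A]|%:R.

Definition upper_density A : \bar R :=
  limn_esup (fun n => (frequency A n)%:E).

Definition lower_density A : \bar R :=
  limn_einf (fun n => (frequency A n)%:E).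

End density.

Section shadowing.
Context {R : realType} {X : metricType R}.
Implicit Types (f : X -> X) (x : nat -> X).

Definition ergodic_pseudo_orbit f (delta : R) x : Prop :=
  frequency [set i | delta <= mdist (f (x i)) (x i.+1)] n @[n --> \oo] --> (0 : R).

Definition average_pseudo_orbit f (delta : R) x : Prop :=
  exists2 N : nat, (0 < N)%N &
    forall n k : nat, (N <= n)%N ->
      n%:R^-1 * (\sum_(i < n) mdist (f (x (i + k)%N)) (x (i + k).+1)) < delta.

Definition average_shadowing f : Prop :=
  forall eps : R, 0 < eps ->
  exists2 delta : R, 0 < delta &
    forall x, average_pseudo_orbit f delta x ->
    exists z : X,
      (limn_esup
        (fun n => (n%:R^-1 * (\sum_(i < n) mdist (iter i f z) (x i)))%:E)
       < eps%:E)%E.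

Definition shadowing_set f (eps : R) (z : X) x : set nat :=
  [set i | mdist (iter i f z) (x i) < eps].

Definition lower_density_shadowing f : Prop :=
  forall eps : R, 0 < eps ->
  exists2 delta : R, 0 < delta &
    forall x, ergodic_pseudo_orbit f delta x ->
    exists z : X, (0 < lower_density (shadowing_set f eps z x) :> \bar R)%E.

Definition upper_density_shadowing f : Prop :=
  forall eps : R, 0 < eps ->
  exists2 delta : R, 0 < delta &
    forall x, ergodic_pseudo_orbit f delta x ->
    exists z : X,
      ((2^-1)%:E < upper_density (shadowing_set f eps z x) :> \bar R)%E.

End shadowing.

(* Main.v *)
Require Import Defs.
From mathcomp Require Import all_boot all_order all_algebra.
From mathcomp Require Import all_classical all_reals all_analysis.
From mathcomp Require Import zify ring lra.

(** The idea is that a pseudo-orbit [x] whose errors are at least [delta] only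
on a set [E] of density zero differs, on a set of density zero, from a genuine
average-pseudo-orbit, to which average shadowing applies.  The only obstacle is
that [E], although of density zero, may contain arbitrarily long intervals, so
that the averages of the errors of [x] over windows need not be uniformly small.

Cut the time axis into blocks of a fixed length [N].  Inside each block follow
[x] up to the first time in [E], then follow the true [f]-orbit of the current
point until the end of the block, where the sequence is reset to [x].  The
resulting sequence [reset_orbit] makes only errors smaller than [delta] inside a
block, and its errors at the block boundaries are at most [D], a bound on the
distances in the compact space.  Hence its average error over any [n >= N]
consecutive times is at most [delta + 2 D / N]
([average_pseudo_orbit_reset_orbit]), which is small once [N] is large.  Each
time in [E] spoils at most the [N] following times, so that [x] and the new
sequence disagree on a set of density zero ([sum_reset_orbit_neq]).

By Markov's inequality a point that traces the new sequence with a small average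
error is within [eps] of it outside a set of small upper density, hence within
[eps] of [x] on a set of lower density as close to 1 as desired
([average_shadowing_lower_density]).  Both the lower and the upper density
shadowing properties follow. *)

Import Order.TTheory GRing.Theory Num.Theory.
Import numFieldNormedType.Exports.

Local Open Scope classical_set_scope.
Local Open Scope ring_scope.

(** * Densities and upper limits *)

Lemma frequencyE (R : realType) (A : set nat) (n : nat) :
  frequency A n = n%:R^-1 * \sum_(i < n) (nat_of_ord i \in A)%:R :> R.
Proof.
by rewrite /frequency -sum1_card natr_sum [in LHS]big_mkcond/=; congr (_ * _);
  apply: eq_bigr => i _; rewrite inE; case: ifP.
Qed.

Lemma limn_esup_lt_near (R : realType) (u : nat -> \bar R) (a : \bar R) :
  (limn_esup u < a)%E -> \forall n \near \oo, (u n < a)%E.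
Proof.
move=> /ereal_inf_lt[_ [V nV <-]] supVa.
near=> n; apply: le_lt_trans supVa.
by apply: ereal_sup_ubound; exists n => //; near: n.
Unshelve. all: by end_near. Qed.

Lemma le_limn_einf_near (R : realType) (u : nat -> \bar R) (a : \bar R) :
  (\forall n \near \oo, (a <= u n)%E) -> (a <= limn_einf u)%E.
Proof.
move=> [m _ au]; rewrite limn_einf_lim.
apply: lime_ge; first exact: is_cvg_einfs.
exists m => // n mn; apply: le_ereal_inf_tmp => _ [p /= np <-].
by apply: au; exact: leq_trans np.
Qed.

(** * Diameter of a compact metric space *)

Lemma compact_mdist_bounded (R : realType) (X : metricType R) :
  compact [set: X] -> exists2 D : R, 0 < D & forall x y : X, mdist x y <= D.
Proof.
move=> cptX; have [[x0 _]|X0] := pselect (exists x : X, True); last first.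
  by exists 1 => // x; exfalso; apply: X0; exists x.
have /(_ R (pinfty_nbhs R) (fun r x => mdist x0 x < r) _)[|r [_ far]] :=
  (compact_near_coveringP _).1 cptX.
  move=> x _; exists (ball x 1, [set r | mdist x0 x + 1 < r]) => /=.
    split; first exact: nbhsx_ballx.
    by exists (mdist x0 x + 1); split=> //; rewrite num_real.
  move=> [y s]/=; rewrite ballEmdist/= => -[xy xs].
  by apply: lt_trans xs; rewrite (le_lt_trans (metric_triangle _ x _)) ?ltrD2l.
have near_x0 (x : X) : mdist x0 x < `|r| + 1.
  by apply: far => //; rewrite (le_lt_trans (ler_norm r)) ?ltrDl.
exists ((`|r| + 1) + (`|r| + 1)); first by rewrite addr_gt0// ltr_wpDl.
move=> x y; rewrite (le_trans (metric_triangle _ x0 _))//.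
by rewrite lerD// ltW// metric_sym.
Qed.

(** * Resetting a pseudo-orbit at regular times *)

(** The sequence [y] follows [x] until the first time of [E] in each block of
length [N], and then the orbit of [f] up to the end of the block.  The test
[y i = x i] is how the recursion remembers that it has not yet left [x], or has
met it again by chance, which does no harm. *)
Fixpoint reset_orbit {R : realType} {X : metricType R} (f : X -> X)
    (x : nat -> X) (E : set nat) (N i : nat) : X :=
  if i is j.+1 then
    let y := reset_orbit f x E N j in
    if (N %| j.+1)%N || ((y == x j) && (j \notin E)) then x j.+1 else f y
  else x 0%N.

Section reset_orbit.
Context {R : realType} {X : metricType R}.
Variables (f : X -> X) (x : nat -> X) (E : set nat) (N : nat).
Hypothesis N_gt0 : (0 < N)%N.
Local Notation y := (reset_orbit f x E N).

(** Each time of [E] spoils at most the [N] times that follow it.  The second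
summand counts the times to the end of the current block when [y] has already
left [x]: these have been paid for by a visit to [E], and including them makes
the bound provable by induction. *)
Lemma sum_reset_orbit_neq_block n :
  (\sum_(i < n) (y i != x i) + (y n != x n) * (N - n %% N)
   <= N * \sum_(i < n) (nat_of_ord i \in E))%N.
Proof.
elim: n => [|n IHn]; first by rewrite !big_ord0/= eqxx.
rewrite !big_ord_recr/=; move: IHn.
set S := \sum_(i < n) _; set T := \sum_(i < n) _.
have := ltn_pmod n N_gt0; have := ltn_pmod n.+1 N_gt0.
case: (boolP (N %| n.+1)%N) => /= [_|Nn]; first by rewrite eqxx; nia.
have -> : (n.+1 %% N = (n %% N).+1)%N by rewrite modnS (negbTE Nn).
have [yx|yx] := eqVneq (y n) (x n) => /=; last first.
  by case: (_ != _) => /=; nia.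
case: (boolP (n \in E)) => /= _; last by rewrite eqxx/=; nia.
by case: (_ != _) => /=; nia.
Qed.

Lemma sum_reset_orbit_neq n :
  (\sum_(i < n) (y i != x i) <= N * \sum_(i < n) (nat_of_ord i \in E))%N.
Proof. exact: leq_trans (leq_addr _ _) (sum_reset_orbit_neq_block n). Qed.

Lemma mdist_reset_orbit (delta D : R) i : 0 <= delta ->
  (forall a b : X, mdist a b <= D) ->
  (forall j, j \notin E -> mdist (f (x j)) (x j.+1) <= delta) ->
  mdist (f (y i)) (y i.+1) <= delta + D * (N %| i.+1)%:R.
Proof.
move=> delta0 leD small /=; case: (boolP (N %| i.+1)%N) => /= [_|_].
  by rewrite mulr1 (le_trans (leD _ _))// lerDr.
rewrite mulr0 addr0; case: ifP => [/andP[/eqP -> /small//]|_].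
by rewrite mdistxx.
Qed.

End reset_orbit.

(** A window of length [n] contains at most [n / N + 1] multiples of [N]. *)
Lemma sum_dvdn_window (N n k : nat) : (0 < N)%N ->
  (N * \sum_(i < n) (N %| (i + k).+1) <= n + N)%N.
Proof.
move=> N_gt0.
have count : (\sum_(i < n) (N %| (i + k).+1) + k %/ N = (n + k) %/ N)%N.
  elim: n => [|n IHn]; first by rewrite big_ord0.
  by rewrite big_ord_recr/= addSn divnS// -IHn addnAC addnC addnA.
have := divn_eq k N; have := ltn_pmod k N_gt0.
have := leq_divM (n + k) N; rewrite -count.
by set S := \sum_(i < n) _; set q := (k %/ N)%N; nia.
Qed.

Lemma average_pseudo_orbit_reset_orbit (R : realType) (X : metricType R)
    (f : X -> X) (x : nat -> X) (E : set nat) (N : nat) (delta D e : R) :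
  0 <= delta -> (0 < N)%N ->
  (forall a b : X, mdist a b <= D) ->
  (forall j, j \notin E -> mdist (f (x j)) (x j.+1) <= delta) ->
  delta + 2 * D / N%:R < e ->
  average_pseudo_orbit f e (reset_orbit f x E N).
Proof.
move=> delta0 N_gt0 leD small e_big; exists N => // n k Nn.
have n_gt0 : (0 < n)%N by exact: leq_trans Nn.
have D0 : 0 <= D by apply: le_trans (leD (x 0%N) (x 0%N)); rewrite mdist_ge0.
apply: le_lt_trans e_big; rewrite mulrC ler_pdivrMr ?ltr0n//.
pose c := (\sum_(i < n) (N %| (i + k).+1))%N.
have c_le : c%:R <= 2 * n%:R / N%:R :> R.
  rewrite ler_pdivlMr ?ltr0n// -!natrM ler_nat mulnC.
  by have := @sum_dvdn_window N n k N_gt0; rewrite -/c; lia.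
have errors : \sum_(i < n) mdist (f (reset_orbit f x E N (i + k)))
    (reset_orbit f x E N (i + k).+1) <= n%:R * delta + D * c%:R.
  have -> : n%:R * delta + D * c%:R =
      \sum_(i < n) (delta + D * (N %| (i + k).+1)%:R).
    by rewrite big_split/= sumr_const card_ord -mulr_sumr -natr_sum mulr_natl.
  by apply: ler_sum => i _; exact: mdist_reset_orbit.
apply: le_trans errors _; rewrite mulrDl mulrC lerD2l.
rewrite (_ : 2 * D / N%:R * n%:R = D * (2 * n%:R / N%:R)); last by ring.
exact: ler_wpM2l.
Qed.

(** * Tracing on a set of large lower density *)

(** Markov's inequality at time [n]: a time at which [z] is not [eps]-close to
[x] either sees a difference between [x] and [y], or contributes at least [eps]
to the sum of the distances between the orbit of [z] and [y]. *)
Lemma frequency_shadowing_set_ge (R : realType) (X : metricType R) (f : X -> X)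
    (x y : nat -> X) (z : X) (eps : R) (n : nat) : 0 < eps -> (0 < n)%N ->
  1 <= frequency (shadowing_set f eps z x) n
       + n%:R^-1 * (\sum_(i < n) (y i != x i))%:R
       + eps^-1 * (n%:R^-1 * \sum_(i < n) mdist (iter i f z) (y i)).
Proof.
move=> eps0 n_gt0; rewrite frequencyE natr_sum mulrCA -!mulrDr mulr_sumr.
rewrite -!big_split/= ler_pdivlMl ?ltr0n// mulr1.
rewrite -[n in n%:R]card_ord -sumr_const; apply: ler_sum => i _.
have d0 : 0 <= eps^-1 * mdist (iter i f z) (y i).
  by rewrite mulr_ge0 ?invr_ge0 ?mdist_ge0// ltW.
have [yx|_] := eqVneq (y i) (x i); last by case: (_ \in _) => /=; lra.
case: (boolP (_ \in _)) => /= [_|]; first by lra.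
rewrite notin_setE => /negP; rewrite -leNgt -yx => far.
by rewrite !add0r ler_pdivlMl ?mulr1.
Qed.

Lemma average_shadowing_lower_density (R : realType) (X : metricType R)
    (f : X -> X) (eps eta : R) :
  compact [set: X] -> average_shadowing f -> 0 < eps -> 0 < eta ->
  exists2 delta : R, 0 < delta & forall x, ergodic_pseudo_orbit f delta x ->
    exists z : X,
      ((1 - eta)%:E <= lower_density (shadowing_set f eps z x))%E.
Proof.
move=> /compact_mdist_bounded[D D0 leD] avg eps0 eta0.
have eps'0 : 0 < eps * (eta / 2) by rewrite !mulr_gt0.
have [e e0 tracing] := avg _ eps'0.
have e20 : 0 < e / 2 by rewrite divr_gt0.
exists (e / 2) => // x ergx.
(* [N] is chosen so that [2 D / N < e / 2]. *)
pose N := (Num.truncn (4 * D / e)).+1.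
have N_gt0 : (0 < N)%N by [].
have N_big : 4 * D / e < N%:R by exact: truncnS_gt.
set E := [set i | e / 2 <= mdist (f (x i)) (x i.+1)] in ergx.
set y := reset_orbit f x E N.
have /tracing[z /limn_esup_lt_near avg_z] : average_pseudo_orbit f e y.
  apply: (@average_pseudo_orbit_reset_orbit _ _ _ _ _ _ (e / 2) D) => //.
  - exact: ltW.
  - by move=> j; rewrite notin_setE => /negP; rewrite -ltNge => /ltW.
  - have : 2 * D / N%:R < e / 2; last by lra.
    move: N_big; rewrite !ltr_pdivrMr// ?ltr0n// => N_big; lra.
exists z; apply: le_limn_einf_near.
have E_small : \forall n \near \oo, frequency E n < eta / 2 / N%:R.
  by apply: (cvgr_lt _ ergx); rewrite !divr_gt0 ?ltr0n.
near=> n; rewrite lee_fin.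
have n_gt0 : (0 < n)%N by near: n; exact: nbhs_infty_gt.
have fE : N%:R * frequency E n < eta / 2.
  by rewrite mulrC -ltr_pdivlMr ?ltr0n//; near: n.
have dz : eps^-1 * (n%:R^-1 * \sum_(i < n) mdist (iter i f z) (y i)) < eta / 2.
  by rewrite ltr_pdivrMl// -lte_fin; near: n.
have y_neq : n%:R^-1 * (\sum_(i < n) (y i != x i))%:R <=
    N%:R * frequency E n :> R.
  rewrite frequencyE mulrCA ler_wpM2l ?invr_ge0// -natr_sum -natrM ler_nat.
  exact: sum_reset_orbit_neq.
have := @frequency_shadowing_set_ge _ _ f x y z eps n eps0 n_gt0.
by lra.
Unshelve. all: by end_near. Qed.

Theorem corollary5p7 (R : realType) (X : metricType R) (f : X -> X)
    (cptX : compact [set: X]) (ctsf : continuous f) :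
  average_shadowing f ->
  lower_density_shadowing f /\ upper_density_shadowing f.
Proof.
move=> avg.
have dense eps : 0 < eps -> exists2 delta : R, 0 < delta &
    forall x, ergodic_pseudo_orbit f delta x -> exists z : X,
      ((2^-1)%:E < lower_density (shadowing_set f eps z x) :> \bar R)%E.
  move=> eps0; have eta0 : 0 < 4^-1 :> R by rewrite invr_gt0.
  have [delta d0 H] :=
    @average_shadowing_lower_density _ _ _ _ _ cptX avg eps0 eta0.
  exists delta => // x /H[z zP]; exists z; apply: lt_le_trans zP.
  by rewrite lte_fin; lra.
split=> eps /dense[delta d0 H]; exists delta => // x /H[z zP]; exists z.
  by apply: lt_trans zP; rewrite lte_fin invr_gt0.
exact: lt_le_trans zP (limn_einf_sup _).
Qed.
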